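(* Let $n\ge2$, $b>0$, let $\mathbb{T}\subset\mathbb{R}$ be an interval, and for $t\in\mathbb{T}$ let $\mathcal{L}(t)u=u^{(n)}+\sum_{k=0}^{n-2}p_k(x;t)u^{(k)}$, where each $p_k(x;t)$ is complex-valued, $C^\infty$ and $b$-periodic in $x$, depends smoothly on $t$, and $|p_k(x;t)|\le M$ for all $x\in\mathbb{R}$, $t\in\mathbb{T}$, $k=0,\dots,n-2$, for some constant $M$. Let $u_j(x;\lambda;t)$ be the fundamental solutions of $\mathcal{L}(t)u=\lambda u$ ($u_j^{(i-1)}(0;\lambda;t)=\delta_{ij}$) and $$H(\lambda;t)=\det\left[u_j((i-1)b;\lambda;t)\right]_{1\le i,j\le n}.$$ Let $\tilde H(\lambda)$ be the corresponding function for the operator $d^n/dx^n$, namely $$\tilde H(\lambda)=\prod_{0\le j<k\le n-1}\frac{\exp(\rho^k\lambda^{1/n}b)-\exp(\rho^j\lambda^{1/n}b)}{(\rho^k-\rho^j)\lambda^{1/n}},\qquad\rho=e^{2\pi i/n}.$$ Then for every fixed $\delta>0$, $$H(\lambda;t)=\tilde H(\lambda)\left[1+O\left(\lambda^{-1/n}\right)\right]\quad\text{as }\lambda\to\infty,\ \lambda^{1/n}\notin E_\delta,$$ uniformly in $t\in\mathbb{T}$.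
   Context: $\lambda^{1/n}$ denotes the principal $n$-th root. The zeros of $H(\lambda;t)$ are the eigenvalues of the multipoint problem $\mathcal{L}(t)u=\lambda u$, $u(0)=u(b)=\cdots=u((n-1)b)=0$. The set $E_\delta$ is $$E_\delta=\bigcup_{m\in\mathbb{Z}}\ \bigcup_{1\le j<k\le n}\left\{z\in\mathbb{C}:\left|z-\frac{\pi m}{b\sin(\pi(k-j)/n)}e^{-\pi(j+k-2)i/n}\right|<\delta\right\}.$$ *)

(* Defs.v *)
From HB Require Import structures.
From mathcomp Require Import all_boot all_order all_algebra.
From mathcomp Require Import all_classical all_reals all_analysis.
From mathcomp Require Import complex.
Set Implicit Arguments. Unset Strict Implicit. Unset Printing Implicit Defensive.
Import Order.TTheory GRing.Theory Num.Theory.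
Import numFieldNormedType.Exports.
Local Open Scope ring_scope.
Local Open Scope complex_scope.

Section Defs.
Variable R : realType.

Definition reC (z : R[i]) : R := let: Complex a _ := z in a.
Definition imC (z : R[i]) : R := let: Complex _ c := z in c.

Definition cabs (z : R[i]) : R := Num.sqrt (reC z ^+ 2 + imC z ^+ 2).

Definition cexp (z : R[i]) : R[i] :=
  (expR (reC z) * cos (imC z)) +i* (expR (reC z) * sin (imC z)).

Definition carg (z : R[i]) : R :=
  if z == 0 then 0
  else if 0 <= imC z then acos (reC z / cabs z) else - acos (reC z / cabs z).

Definition proot (n : nat) (z : R[i]) : R[i] :=
  if z == 0 then 0
  else (powR (cabs z) (n%:R^-1))%:C * cexp (0 +i* (carg z / n%:R)).

Definition rho (n : nat) : R[i] := cexp (0 +i* (2 * pi / n%:R)).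

Definition Htilde (n : nat) (b : R) (lam : R[i]) : R[i] :=
  let mu := proot n lam in
  \prod_(j < n) \prod_(k < n | (j < k)%N)
     ((cexp ((rho n) ^+ k * mu * b%:C) - cexp ((rho n) ^+ j * mu * b%:C))
        / (((rho n) ^+ k - (rho n) ^+ j) * mu)).

Definition E_delta (n : nat) (b delta : R) : set R[i] :=
  [set z | exists (m : int) (j k : nat),
      [/\ (1 <= j)%N, (j < k)%N, (k <= n)%N &
       cabs (z - ((pi * m%:~R) / (b * sin (pi * (k - j)%:R / n%:R)))%:C
                 * cexp (0 +i* (- (pi * (j + k - 2)%:R / n%:R)))) < delta]].

Definition cderivn (m : nat) (f : R -> R[i]) (x : R) : R[i] :=
  (derive1n m (fun y => reC (f y)) x) +i* (derive1n m (fun y => imC (f y)) x).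

Definition cdiff_n (n : nat) (f : R -> R[i]) : Prop :=
  forall m x, (m < n)%N ->
    derivable (derive1n m (fun y => reC (f y))) x 1 /\
    derivable (derive1n m (fun y => imC (f y))) x 1.

Fixpoint pderiv (w : seq bool) (f : R -> R -> R) : R -> R -> R :=
  match w with
  | [::] => f
  | true :: w' => fun x t => derive1 (fun y => pderiv w' f y t) x
  | false :: w' => fun x t => derive1 (fun s => pderiv w' f x s) t
  end.

Definition smooth_at (f : R -> R -> R) (x t : R) : Prop :=
  forall w : seq bool,
    derivable (fun y => pderiv w f y t) x 1 /\
    derivable (fun s => pderiv w f x s) t 1 /\
    ((fun z : R * R => pderiv w f z.1 z.2) @ ((x, t) : R * R) --> pderiv w f x t)%classic.

Definition fundamental_system (n : nat) (p : nat -> R -> R[i]) (lam : R[i])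
    (u : nat -> R -> R[i]) : Prop :=
  forall j, (j < n)%N ->
    [/\ cdiff_n n (u j),
        (forall x, cderivn n (u j) x
                   + \sum_(k < n.-1) p k x * cderivn k (u j) x = lam * u j x) &
        (forall i, (i < n)%N -> cderivn i (u j) 0 = (i == j)%:R)].

Definition Hdet (n : nat) (b : R) (u : nat -> R -> R[i]) : R[i] :=
  \det (\matrix_(i < n, j < n) u j (i%:R * b)).

End Defs.

(* Main.v *)
Require Import Defs.
From HB Require Import structures.
From mathcomp Require Import all_boot all_order all_algebra.
From mathcomp Require Import all_classical all_reals all_analysis.
From mathcomp Require Import complex.
From mathcomp Require Import perm ring lra.
Import Order.TTheory GRing.Theory Num.Theory.
Import numFieldNormedType.Exports.
Local Open Scope ring_scope.
Local Open Scope complex_scope.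

(* With mu = lambda^(1/n), every exponent rho^j mu has a solution y_j with
   y_j(x) = exp(rho^j mu x) (1 + O(1/mu)) on [0, nb] and
   y_j^(k)(0) = (rho^j mu)^k (1 + O(1/mu)), because the coefficient of u^(n-1) is absent.
   If C is the matrix of the y_j^(k)(0), then H = det[y_j(ib)] / det C, and both
   determinants are perturbed Vandermonde determinants. Each term of such a determinant
   is at most the product of max(|a_j|, |a_k|) over the pairs j < k, while outside
   E_delta every factor |a_k - a_j| of the Vandermonde product is at least
   c max(|a_j|, |a_k|), so the relative error stays O(1/mu); finally H~ is the
   quotient of the two unperturbed Vandermonde determinants. *)

(** * Modulus and exponential of complex numbers *)

Section ComplexModulus.
Set Implicit Arguments.
Unset Strict Implicit.
Variable R : realType.
Implicit Types (x y z : R[i]) (r : R).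

Lemma cabs_normc z : (cabs z)%:C = `|z|.
Proof. by rewrite normc_def; case: z. Qed.

Lemma eq_cabs z r : `|z| = r%:C -> cabs z = r.
Proof. by rewrite -cabs_normc => -[]. Qed.

Lemma cabsM x y : cabs (x * y) = cabs x * cabs y.
Proof. by apply: eq_cabs; rewrite normrM -!cabs_normc rmorphM. Qed.

Lemma cabs0 : cabs (0 : R[i]) = 0.
Proof. by apply: eq_cabs; rewrite normr0. Qed.

Lemma cabs1 : cabs (1 : R[i]) = 1.
Proof. by apply: eq_cabs; rewrite normr1. Qed.

Lemma cabs_ge0 z : 0 <= cabs z.
Proof. exact: sqrtr_ge0. Qed.

Lemma cabs_eq0 z : (cabs z == 0) = (z == 0).
Proof.
apply/eqP/eqP => [z0|->]; last exact: cabs0.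
by apply/eqP; rewrite -normr_eq0 -cabs_normc z0.
Qed.

Lemma cabs_gt0 z : (0 < cabs z) = (z != 0).
Proof. by rewrite lt0r cabs_eq0 cabs_ge0 andbT. Qed.

Lemma cabsN z : cabs (- z) = cabs z.
Proof. by apply: eq_cabs; rewrite normrN cabs_normc. Qed.

Lemma cabs_sub x y : cabs (x - y) = cabs (y - x).
Proof. by rewrite -cabsN opprB. Qed.

Lemma cabsD x y : cabs (x + y) <= cabs x + cabs y.
Proof. by rewrite -lecR rmorphD /= !cabs_normc ler_normD. Qed.

Lemma cabsB x y : cabs (x - y) <= cabs x + cabs y.
Proof. by rewrite -(cabsN y) cabsD. Qed.

Lemma cabs_lb x y : cabs x - cabs y <= cabs (x - y).
Proof. by rewrite lerBlDr (le_trans _ (cabsD _ _)) ?subrK. Qed.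

Lemma cabsX z k : cabs (z ^+ k) = cabs z ^+ k.
Proof. by elim: k => [|k IH]; rewrite ?cabs1 // !exprS cabsM IH. Qed.

Lemma cabsV z : cabs z^-1 = (cabs z)^-1.
Proof. by apply: eq_cabs; rewrite normfV -cabs_normc fmorphV. Qed.

Lemma cabs_real r : cabs r%:C = `|r|.
Proof. by rewrite /cabs /= expr0n /= addr0 sqrtr_sqr. Qed.

Lemma cabs_sqr z : cabs z ^+ 2 = reC z ^+ 2 + imC z ^+ 2.
Proof. by rewrite sqr_sqrtr // addr_ge0 ?sqr_ge0. Qed.

Lemma cabs_sum (I : Type) (s : seq I) (P : pred I) (F : I -> R[i]) :
  cabs (\sum_(i <- s | P i) F i) <= \sum_(i <- s | P i) cabs (F i).
Proof.
elim/big_rec2: _ => [|i r z _ zr]; first by rewrite cabs0.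
by apply: le_trans (cabsD _ _) _; rewrite lerD2l.
Qed.

Lemma cabs_prod (I : Type) (s : seq I) (P : pred I) (F : I -> R[i]) :
  cabs (\prod_(i <- s | P i) F i) = \prod_(i <- s | P i) cabs (F i).
Proof. by apply: big_morph; [exact: cabsM|exact: cabs1]. Qed.

Lemma reCD x y : reC (x + y) = reC x + reC y.
Proof. by case: x; case: y. Qed.

Lemma imCD x y : imC (x + y) = imC x + imC y.
Proof. by case: x; case: y. Qed.

Lemma reCN x : reC (- x) = - reC x.
Proof. by case: x. Qed.

Lemma imCN x : imC (- x) = - imC x.
Proof. by case: x. Qed.

Lemma reCM x y : reC (x * y) = reC x * reC y - imC x * imC y.
Proof. by case: x; case: y. Qed.

Lemma imCM x y : imC (x * y) = reC x * imC y + imC x * reC y.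
Proof. by case: x; case: y. Qed.

Lemma reC_le_cabs z : `|reC z| <= cabs z.
Proof.
rewrite -[leLHS]sqrtr_sqr /cabs ler_sqrt ?lerDl ?sqr_ge0 //.
by rewrite addr_ge0 ?sqr_ge0.
Qed.

Lemma reC_eq x y : reC x = reC y -> imC x = imC y -> x = y.
Proof. by case: x => a b; case: y => c d /= -> ->. Qed.

Lemma cexpD x y : cexp (x + y) = cexp x * cexp y.
Proof.
by apply: reC_eq; rewrite ?reCM ?imCM /= !reCD !imCD expRD ?cosD ?sinD; ring.
Qed.

Lemma cexp0 : cexp (0 : R[i]) = 1.
Proof. by rewrite /cexp /= expR0 cos0 sin0 mulr1 mulr0. Qed.

Lemma cabs_cexp z : cabs (cexp z) = expR (reC z).
Proof.
rewrite /cabs /= !exprMn -mulrDr cos2Dsin2 mulr1 sqrtr_sqr.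
by rewrite ger0_norm ?expR_ge0.
Qed.

Lemma cexp_neq0 z : cexp z != 0.
Proof. by rewrite -cabs_gt0 cabs_cexp expR_gt0. Qed.

Lemma cexpN z : cexp (- z) = (cexp z)^-1.
Proof. by rewrite -[LHS](mulfK (cexp_neq0 z)) -cexpD addNr cexp0 mul1r. Qed.

Lemma cexpMn z k : cexp (k%:R * z) = cexp z ^+ k.
Proof.
elim: k => [|k IH]; first by rewrite mul0r cexp0.
by rewrite mulrS mulrDl mul1r cexpD IH exprS.
Qed.

Lemma cexp_imM r k : cexp (0 +i* r) ^+ k = cexp (0 +i* (k%:R * r)).
Proof.
rewrite -cexpMn; congr cexp.
elim: k => [|k IH]; first by rewrite !mul0r.
rewrite !mulrS !mulrDl IH !mul1r.
by apply: reC_eq; rewrite ?reCD ?imCD /= ?addr0.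
Qed.

End ComplexModulus.

(** * Derivatives of complex-valued functions of a real variable, and a priori bounds for linear
    systems *)

Section ComplexDerivative.
Set Implicit Arguments.
Unset Strict Implicit.
Variable R : realType.
Implicit Types (f g : R -> R[i]) (a c l m : R[i]) (x y r : R).

(** Stated on real and imaginary parts because [cderivn] and [cdiff_n] differentiate the two parts
    separately. *)
Definition has_cderiv f x l : Prop :=
  is_derive x 1 (fun y => reC (f y)) (reC l) /\
  is_derive x 1 (fun y => imC (f y)) (imC l).

Lemma has_cderiv_ext f g x l :
  (forall y, f y = g y) -> has_cderiv f x l -> has_cderiv g x l.
Proof. by move=> /funext ->. Qed.

Lemma has_cderiv_cst c x : has_cderiv (fun=> c) x 0.
Proof. by split; exact: is_derive_cst. Qed.

Lemma has_cderivD f g x l m :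
  has_cderiv f x l -> has_cderiv g x m -> has_cderiv (fun y => f y + g y) x (l + m).
Proof.
move=> [fr fi] [gr gi]; split.
  rewrite reCD (_ : (fun y => _) = (fun y => reC (f y)) + (fun y => reC (g y))).
    exact: is_deriveD.
  by apply/funext => y; rewrite reCD.
rewrite imCD (_ : (fun y => _) = (fun y => imC (f y)) + (fun y => imC (g y))).
  exact: is_deriveD.
by apply/funext => y; rewrite imCD.
Qed.

Lemma has_cderivM f g x l m :
  has_cderiv f x l -> has_cderiv g x m ->
  has_cderiv (fun y => f y * g y) x (l * g x + f x * m).
Proof.
move=> [fr fi] [gr gi]; split.
  rewrite (_ : (fun y => _) = (fun y => reC (f y)) * (fun y => reC (g y))
             - (fun y => imC (f y)) * (fun y => imC (g y))); last first.
    by apply/funext => y; rewrite reCM.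
  apply: is_derive_eq; rewrite reCD !reCM /GRing.scale /=; ring.
rewrite (_ : (fun y => _) = (fun y => reC (f y)) * (fun y => imC (g y))
             + (fun y => imC (f y)) * (fun y => reC (g y))); last first.
  by apply/funext => y; rewrite imCM.
apply: is_derive_eq; rewrite imCD !imCM /GRing.scale /=; ring.
Qed.

Lemma has_cderivZ c f x l :
  has_cderiv f x l -> has_cderiv (fun y => c * f y) x (c * l).
Proof.
move=> fl; have := has_cderivM (has_cderiv_cst c x) fl.
by rewrite mul0r add0r.
Qed.

Lemma has_cderiv_sum n (h : 'I_n -> R -> R[i]) (dh : 'I_n -> R[i]) x :
  (forall i, has_cderiv (h i) x (dh i)) ->
  has_cderiv (fun y => \sum_i h i y) x (\sum_i dh i).
Proof.
move=> hd; elim: n => [|n IH] in h dh hd *.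
  rewrite big_ord0; apply: has_cderiv_ext (has_cderiv_cst 0 x) => y.
  by rewrite big_ord0.
rewrite big_ord_recl; apply: has_cderiv_ext (has_cderivD (hd _) (IH _ _ _)) => [y|i].
  by rewrite big_ord_recl.
exact: hd.
Qed.

Lemma has_cderiv_cexp a x :
  has_cderiv (fun y => cexp (a * y%:C)) x (a * cexp (a * x%:C)).
Proof.
have re y : reC (a * y%:C) = reC a * y by rewrite reCM /= mulr0 subr0.
have im y : imC (a * y%:C) = imC a * y by rewrite imCM /= mulr0 add0r.
have dE : is_derive x 1 (fun y => expR (reC a * y)) (expR (reC a * x) * reC a).
  have -> : (fun y => expR (reC a * y)) = expR \o (fun y => reC a *: y) by [].
  by apply: is_derive1_comp; apply: is_derive_eq; rewrite /GRing.scale /= mulr1.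
have dC : is_derive x 1 (fun y => cos (imC a * y)) (- sin (imC a * x) * imC a).
  have -> : (fun y => cos (imC a * y)) = cos \o (fun y => imC a *: y) by [].
  by apply: is_derive1_comp; apply: is_derive_eq; rewrite /GRing.scale /= mulr1.
have dS : is_derive x 1 (fun y => sin (imC a * y)) (cos (imC a * x) * imC a).
  have -> : (fun y => sin (imC a * y)) = sin \o (fun y => imC a *: y) by [].
  by apply: is_derive1_comp; apply: is_derive_eq; rewrite /GRing.scale /= mulr1.
split.
  rewrite (_ : (fun y => _) = (fun y => expR (reC a * y)) * (fun y => cos (imC a * y))).
    apply: is_derive_eq; rewrite reCM /= re im /GRing.scale /=; ring.
  by apply/funext => y /=; rewrite re im.
rewrite (_ : (fun y => _) = (fun y => expR (reC a * y)) * (fun y => sin (imC a * y))).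
  apply: is_derive_eq; rewrite imCM /= re im /GRing.scale /=; ring.
by apply/funext => y /=; rewrite re im.
Qed.

Lemma has_cderiv_reflect f r x l :
  has_cderiv f (r - x) l -> has_cderiv (fun y => f (r - y)) x (- l).
Proof.
have d : is_derive x 1 (fun y => r - y) (- 1).
  have -> : (fun y => r - y) = cst r - id by [].
  by apply: is_derive_eq; rewrite sub0r.
move=> [fr fi]; split.
  by rewrite reCN -mulrN1; exact: (@is_derive1_comp R (fun y => reC (f y))).
by rewrite imCN -mulrN1; exact: (@is_derive1_comp R (fun y => imC (f y))).
Qed.

Lemma has_cderiv_continuous f x l : has_cderiv f x l ->
  {for x, continuous (fun y => cabs (f y))}.
Proof.
move=> [[dr _] [di _]]; apply: (@continuous_comp _ _ _
  (fun y => reC (f y) ^+ 2 + imC (f y) ^+ 2) Num.sqrt); last exact: sqrt_continuous.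
apply/differentiable_continuous/derivable1_diffP.
have -> : (fun y => reC (f y) ^+ 2 + imC (f y) ^+ 2) =
  (fun y => reC (f y)) ^+ 2 + (fun y => imC (f y)) ^+ 2.
  by apply/funext => y; rewrite !expr2.
by apply: derivableD; apply: derivableX.
Qed.

(* The modulus |g| is smoothed to sqrt(|g|^2 + e^2), whose derivative is at most F. *)
Lemma forward_bound g (a : R[i]) (h : R -> R[i]) (F L : R) :
  (forall y, has_cderiv g y (a * g y + h y)) -> reC a <= 0 ->
  (forall y, 0 <= y <= L -> cabs (h y) <= F) -> g 0 = 0 ->
  forall x, 0 <= x <= L -> cabs (g x) <= F * x.
Proof.
move=> dg a0 hF g0 x /andP[x0 xL]; apply/ler_addgt0Pr => e e0.
pose q y := reC (g y) ^+ 2 + imC (g y) ^+ 2 + e ^+ 2.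
have q0 y : 0 < q y by rewrite ltr_wpDl ?exprn_gt0// addr_ge0 ?sqr_ge0.
pose D y := (2 * Num.sqrt (q y))^-1 *
  (2 * (reC (a * g y + h y) * reC (g y) + imC (a * g y + h y) * imC (g y))) - F.
have dG y : is_derive y 1 (fun y => Num.sqrt (q y) - F * y) (D y).
  have [dr di] := dg y.
  have dq : is_derive y 1 q
      (2 * (reC (a * g y + h y) * reC (g y) + imC (a * g y + h y) * imC (g y))).
    have -> : q = (fun y => reC (g y)) ^+ 2 + (fun y => imC (g y)) ^+ 2 + cst (e ^+ 2).
      by apply/funext => z; rewrite /q !expr2.
    by apply: is_derive_eq; rewrite /GRing.scale /= ; ring.
  have ds : is_derive y 1 (Num.sqrt \o q) ((2 * Num.sqrt (q y))^-1 *
    (2 * (reC (a * g y + h y) * reC (g y) + imC (a * g y + h y) * imC (g y)))).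
    by apply: is_derive1_comp; exact: is_derive1_sqrt.
  have -> : (fun y => Num.sqrt (q y) - F * y) = (Num.sqrt \o q) - (fun y => F *: y) by [].
  by apply: is_derive_eq; rewrite /GRing.scale /= mulr1.
have gq y : cabs (g y) <= Num.sqrt (q y).
  by rewrite /cabs ler_sqrt ?(ltW (q0 y))// lerDl sqr_ge0.
(* Half the derivative of |g|^2 is Re(a) |g|^2 + Re(h conj g); the first term is nonpositive and the
   second is at most F |g|. *)
have Dle y : 0 <= y <= L -> D y <= 0.
  move=> /hF hy; rewrite /D subr_le0 invfM mulrACA mulVf ?pnatr_eq0// mul1r.
  rewrite mulrC ler_pdivrMr ?sqrtr_gt0//.
  have -> : reC (a * g y + h y) * reC (g y) + imC (a * g y + h y) * imC (g y) =
     reC a * cabs (g y) ^+ 2 + reC (h y * (g y)^*).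
    rewrite cabs_sqr reCD imCD !reCM imCM.
    by case: (g y) => u v /=; ring.
  have -> : F * Num.sqrt (q y) = 0 + F * Num.sqrt (q y) by rewrite add0r.
  apply: lerD; first by rewrite mulr_le0_ge0 ?sqr_ge0.
  apply: le_trans (ler_norm _) _; apply: le_trans (reC_le_cabs _) _.
  rewrite cabsM (_ : cabs (g y)^* = cabs (g y)); last first.
    by rewrite /cabs; case: (g y) => u v /=; rewrite sqrrN.
  by rewrite ler_pM ?cabs_ge0.
have := @ler0_derive1_nincr R (fun y => Num.sqrt (q y) - F * y) 0 x _ _ _ 0 x
  (lexx _) x0 (lexx _).
have -> : Num.sqrt (q 0) = e.
  by rewrite /q g0 /= expr0n /= !add0r sqrtr_sqr gtr0_norm.
rewrite mulr0 subr0 => H.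
have {}H : Num.sqrt (q x) - F * x <= e.
  apply: H => [y _|y|].
  - by have [] := dG y.
  - rewrite in_itv /= => /andP[y0 yx]; rewrite derive1E.
    have [_ ->] := dG y; apply: Dle; rewrite (ltW y0) /=.
    exact: le_trans (ltW yx) xL.
  - apply: continuous_subspaceT => y.
    by apply/differentiable_continuous/derivable1_diffP; have [] := dG y.
by apply: le_trans (gq x) _; rewrite addrC -lerBlDr.
Qed.

(** Reversing the variable, y -> L - y, turns a into -a, so the forward bound applies. *)
Lemma backward_bound g (a : R[i]) (h : R -> R[i]) (F L : R) :
  (forall y, has_cderiv g y (a * g y + h y)) -> 0 <= reC a ->
  (forall y, 0 <= y <= L -> cabs (h y) <= F) -> g L = 0 ->
  forall x, 0 <= x <= L -> cabs (g x) <= F * (L - x).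
Proof.
move=> dg a0 hF gL x /andP[x0 xL].
have := @forward_bound (fun y => g (L - y)) (- a) (fun y => - h (L - y)) F L.
move=> /(_ _ _ _ _ (L - x)); rewrite subKr; apply.
- by move=> y; rewrite mulNr -opprD; exact: has_cderiv_reflect.
- by rewrite reCN oppr_le0.
- by move=> y /andP[y0 yL]; rewrite cabsN hF// subr_ge0 yL gerBl.
- by rewrite subr0.
- by rewrite subr_ge0 xL gerBl.
Qed.

(* Data are prescribed at 0 for the non-growing components and at L for the growing
   ones, so that each equation is integrated in its stable direction; at a maximum
   point of the sum of the |w k| the coupling is then absorbed. *)
Lemma dichotomy_bound n (w h : 'I_n -> R -> R[i]) (a : 'I_n -> R[i]) (j : 'I_n)
    (d : R[i]) (kappa L : R) :
  0 <= L -> 0 <= kappa -> n%:R * (kappa * L) <= 2^-1 ->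
  (forall i y, has_cderiv (w i) y (a i * w i y + h i y)) ->
  (forall i y, 0 <= y <= L -> cabs (h i y) <= kappa * \sum_k cabs (w k y)) ->
  a j = 0 ->
  (forall i, w i (if reC (a i) <= 0 then 0 else L) = (i == j)%:R * d) ->
  forall i y, 0 <= y <= L ->
    cabs (w i y - (i == j)%:R * d) <= 2 * (kappa * L) * cabs d.
Proof.
move=> L0 k0 kL dw hw aj wd.
pose S y := \sum_k cabs (w k y).
have [c cL cmax] : exists2 c, c \in `[0, L] & forall t, t \in `[0, L] -> S t <= S c.
  apply: EVT_max => //; apply: continuous_subspaceT.
  apply: (@continuous_big R _ +%R 0 xpredT) => [|i _ z].
    exact: add_continuous.
  exact: has_cderiv_continuous (dw i z).
have bnd i y : 0 <= y <= L -> cabs (w i y - (i == j)%:R * d) <= kappa * S c * L.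
  move=> /[dup] yL /andP[y0 yleL].
  (* Because [a j = 0], the constant d solves the j-th homogeneous equation; subtracting it keeps
     the forcing and makes the boundary value zero. *)
  have dg z : has_cderiv (fun z => w i z - (i == j)%:R * d) z
      (a i * (w i z - (i == j)%:R * d) + h i z).
    have := has_cderivD (dw i z) (has_cderiv_cst (- ((i == j)%:R * d)) z).
    congr has_cderiv; rewrite addr0.
    by case: eqP => [->|_]; rewrite ?aj mul0r ?subr0 // mul0r.
  have hF z : 0 <= z <= L -> cabs (h i z) <= kappa * S c.
    by move=> zL; apply: le_trans (hw _ _ zL) _; rewrite ler_wpM2l// cmax// in_itv.
  have F0 : 0 <= kappa * S c by rewrite mulr_ge0// sumr_ge0// => k _; exact: cabs_ge0.
  have := wd i; case: ifPn => [ai wi|]; last rewrite -ltNge => /ltW ai wi.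
    apply: le_trans (forward_bound dg ai hF _ yL) _; first by rewrite wi subrr.
    by rewrite ler_wpM2l.
  apply: le_trans (backward_bound dg ai hF _ yL) _; first by rewrite wi subrr.
  by rewrite ler_wpM2l// gerBl.
(* Summing [bnd] at the maximum point gives S c <= n kappa L S c + |d|, whose first term is at most
   S c / 2; hence the factor 2. *)
have Sc : S c <= 2 * cabs d.
  have : S c <= \sum_i (kappa * S c * L + (i == j)%:R * cabs d).
    apply: ler_sum => i _; rewrite in_itv /= in cL.
    rewrite -[in leLHS](subrK ((i == j)%:R * d) (w i c)).
    apply: le_trans (cabsD _ _) _; rewrite lerD ?bnd// cabsM.
    by case: eqP => _; rewrite ?cabs1 ?cabs0.
  rewrite big_split /= sumr_const card_ord.
  rewrite (bigD1 j) //= eqxx mul1r big1 ?addr0; last first.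
    by move=> i /negbTE ->; rewrite mul0r.
  have S0 : 0 <= S c by apply: sumr_ge0 => k _; exact: cabs_ge0.
  rewrite -[X in _ <= X + _]mulr_natl mulrAC mulrA => H.
  have : n%:R * (kappa * L) * S c <= 2^-1 * S c by rewrite ler_wpM2r.
  lra.
move=> i y yL; apply: le_trans (bnd i y yL) _.
have : kappa * L * S c <= kappa * L * (2 * cabs d).
  by rewrite ler_wpM2l// mulr_ge0.
lra.
Qed.

End ComplexDerivative.

(** * Stability of Vandermonde determinants under relative perturbation of the entries *)

Section PerturbedVandermonde.
Set Implicit Arguments.
Unset Strict Implicit.
Variable R : realType.

(** Induction peeling off one factor: |x_0| <= 2 |z_0| because eps <= 1, and the constants obey 2
    (2^n - 1) + 1 = 2^(n+1) - 1. *)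
Lemma prod_perturb n (x z : 'I_n -> R[i]) (eps : R) : 0 <= eps <= 1 ->
  (forall i, cabs (x i - z i) <= eps * cabs (z i)) ->
  cabs (\prod_i x i - \prod_i z i) <= (2 ^+ n - 1) * eps * \prod_i cabs (z i).
Proof.
move=> /andP[e0 e1]; elim: n => [|n IH] in x z * => xz.
  by rewrite !big_ord0 subrr cabs0 expr0 subrr !mul0r.
rewrite !big_ord_recl.
set X := \prod_(i < n) _; set Z := \prod_(i < n) z _; set P := \prod_(i < n) cabs _.
have XZ : cabs (X - Z) <= (2 ^+ n - 1) * eps * P by apply: IH => i; exact: xz.
have ZP : cabs Z = P by rewrite cabs_prod.
have P0 : 0 <= P by rewrite -ZP cabs_ge0.
have x0 : cabs (x ord0) <= 2 * cabs (z ord0).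
  rewrite -[in leLHS](subrK (z ord0) (x ord0)); apply: le_trans (cabsD _ _) _.
  have := xz ord0; have := ler_wpM2r (cabs_ge0 (z ord0)) e1; lra.
have -> : x ord0 * X - z ord0 * Z = x ord0 * (X - Z) + (x ord0 - z ord0) * Z by ring.
apply: le_trans (cabsD _ _) _; rewrite !cabsM ZP.
have := ler_pM (cabs_ge0 _) (cabs_ge0 _) x0 XZ.
have := ler_wpM2r P0 (xz ord0).
rewrite exprS; lra.
Qed.

(** The pairs k != i split into i < k and k < i, and symmetry of [m] makes both halves equal. The
    right-hand side is visibly invariant under relabelling. *)
Lemma prod_lt_sqr n (m : 'I_n -> 'I_n -> R) : (forall j k, m j k = m k j) ->
  (\prod_(i < n) \prod_(k < n | (i < k)%N) m i k) ^+ 2 = \prod_(i < n) \prod_(k | k != i) m i k.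
Proof.
move=> msym; rewrite expr2 [X in _ * X](exchange_big_dep xpredT) //=.
rewrite -big_split /=; apply: eq_bigr => i _.
rewrite [RHS](bigID (fun k : 'I_n => (i < k)%N)) /=; congr (_ * _).
  by apply: eq_bigl => k; rewrite -val_eqE /= neq_ltn; case: ltngtP.
by apply: eq_big => [k|k _]; [rewrite -val_eqE /=; case: ltngtP | exact: msym].
Qed.

(** A permutation may reverse some pairs i < k, so the squares are compared by reindexing, and
    nonnegativity allows taking roots. *)
Lemma prod_lt_perm n (m : 'I_n -> 'I_n -> R) (s : 'S_n) :
  (forall j k, m j k = m k j) -> (forall j k, 0 <= m j k) ->
  \prod_(i < n) \prod_(k < n | (i < k)%N) m (s i) (s k) =
  \prod_(i < n) \prod_(k < n | (i < k)%N) m i k.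
Proof.
move=> msym m0; apply: (@pexpIrn _ 2) => //; rewrite ?nnegrE; try
  by apply: prodr_ge0 => i _; apply: prodr_ge0.
rewrite !prod_lt_sqr// [RHS](reindex_inj (@perm_inj _ s)) /=.
apply: eq_bigr => i _; rewrite [RHS](reindex_inj (@perm_inj _ s)) /=.
by apply: eq_bigl => k; rewrite (inj_eq perm_inj).
Qed.

(* The exponent i counts the k < i, which turns the monomial into a product over pairs. *)
Lemma prod_exp_le n (r : 'I_n -> R) (s : 'S_n) : (forall i, 0 <= r i) ->
  \prod_i r (s i) ^+ i <= \prod_(i < n) \prod_(k < n | (i < k)%N) Num.max (r i) (r k).
Proof.
move=> r0; rewrite -(prod_lt_perm (m := fun i k => Num.max (r i) (r k)) s); last 2 first.
- by move=> j k; rewrite maxC.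
- by move=> j k; rewrite le_max r0.
have -> : \prod_i r (s i) ^+ i = \prod_(i < n) \prod_(k < n | (k < i)%N) r (s i).
  apply: eq_bigr => i _.
  by rewrite -(big_ord_widen _ (fun=> r (s i)) (ltnW (ltn_ord i))) prodr_const card_ord.
rewrite (exchange_big_dep xpredT) //=; apply: ler_prod => i _.
rewrite prodr_ge0//=; apply: ler_prod => k _.
by rewrite r0 /= le_max lexx orbT.
Qed.

(** Each Leibniz term changes by at most (2^n - 1) eps times a monomial bounded by the product P of
    pairwise maxima, while the separation bounds the Vandermonde determinant below by a constant
    times P. *)
Lemma perturbed_Vandermonde n (c : R) : 0 < c ->
  exists2 K : R, 0 < K & forall (a : 'I_n -> R[i]) (A : 'M[R[i]]_n) (eps : R),
    (forall j k : 'I_n, (j < k)%N ->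
      c * Num.max (cabs (a j)) (cabs (a k)) <= cabs (a k - a j)) ->
    0 <= eps <= 1 ->
    (forall i j, cabs (A i j - a j ^+ i) <= eps * cabs (a j) ^+ i) ->
    cabs (\det A - \det (Vandermonde n (\row_j a j))) <=
      K * eps * cabs (\det (Vandermonde n (\row_j a j))).
Proof.
move=> c0; pose q := \prod_(i < n) \prod_(k < n | (i < k)%N) c.
have q0 : 0 < q by apply: prodr_gt0 => i _; exact: prodr_gt0.
(* n! counts the permutations, 2^n comes from [prod_perturb], and 1/q from the lower bound [PV]. *)
exists ((n`!)%:R * 2 ^+ n / q).
  by rewrite divr_gt0// mulr_gt0 ?exprn_gt0// ltr0n fact_gt0.
move=> a A eps sep eps01 Aa.
pose P := \prod_(i < n) \prod_(k < n | (i < k)%N) Num.max (cabs (a i)) (cabs (a k)).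
have m0 (i k : 'I_n) : 0 <= Num.max (cabs (a i)) (cabs (a k)).
  by rewrite le_max cabs_ge0.
have P0 : 0 <= P by apply: prodr_ge0 => i _; exact: prodr_ge0.
have /andP[e0 e1] := eps01.
have PV : q * P <= cabs (\det (Vandermonde n (\row_j a j))).
  rewrite det_Vandermonde cabs_prod -big_split /=; apply: ler_prod => i _.
  rewrite mulr_ge0 ?prodr_ge0//=; last by move=> k _; exact: ltW.
  rewrite cabs_prod -big_split /=; apply: ler_prod => k ik.
  by rewrite mulr_ge0 ?(ltW c0)// !mxE sep.
have : cabs (\det A - \det (Vandermonde n (\row_j a j))) <= (n`!)%:R * 2 ^+ n * eps * P.
  rewrite /determinant -sumrB; apply: le_trans (cabs_sum _ _ _) _.
  rewrite -!mulrA -(card_Sn n) -sum1_card natr_sum mulr_suml.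
  apply: ler_sum => s _; rewrite mul1r -mulrBr cabsM cabsX cabsN cabs1 expr1n mul1r.
  rewrite [X in _ - X](eq_bigr (fun i => a (s i) ^+ i)); last first.
    by move=> i _; rewrite !mxE.
  apply: le_trans (@prod_perturb n _ _ eps eps01 _) _ => [i|].
    by rewrite cabsX; exact: Aa.
  rewrite mulrA; apply: ler_pM.
  - by rewrite mulr_ge0// subr_ge0 exprn_ege1// ler1n.
  - by apply: prodr_ge0 => i _; exact: cabs_ge0.
  - by rewrite ler_wpM2r// gerBl.
  - under eq_bigr do rewrite cabsX.
    by apply: prod_exp_le => i; exact: cabs_ge0.
move=> /le_trans; apply; set V := cabs _.
have -> : (n`!)%:R * 2 ^+ n / q * eps * V = (n`!)%:R * 2 ^+ n * eps * (q^-1 * V).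
  by rewrite -!mulrA; congr (_ * (_ * _)); rewrite mulrCA.
by rewrite ler_wpM2l ?mulr_ge0 ?exprn_ge0// ler_pdivlMl.
Qed.

(** Since |c| >= |W| / 2, it suffices to bound (d - V/W) c, which equals (y - V) - (c - W) V/W. *)
Lemma quotient_perturb (d y c V W : R[i]) (alpha beta : R) :
  y = d * c -> W != 0 -> beta <= 2^-1 ->
  cabs (y - V) <= alpha * cabs V -> cabs (c - W) <= beta * cabs W ->
  cabs (d - V / W) <= 2 * (alpha + beta) * cabs (V / W).
Proof.
move=> yE W0 b2 yV cW; have w0 : 0 < cabs W by rewrite cabs_gt0.
have cw : cabs W / 2 <= cabs c.
  have := cabs_lb W (W - c); rewrite subKr cabs_sub => h.
  have := ler_wpM2r (ltW w0) b2; lra.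
have : cabs (d - V / W) * cabs c <= alpha * cabs V + beta * cabs V.
  rewrite -cabsM (_ : _ * c = (y - V) - (c - W) * (V / W)); last first.
    by rewrite yE; field.
  apply: le_trans (cabsB _ _) _; apply: lerD => //.
  rewrite !cabsM cabsV; apply: le_trans (ler_wpM2r _ cW) _.
    by rewrite divr_ge0 ?cabs_ge0.
  by rewrite mulrCA -mulrA mulfV ?mulr1 1?mulrC// gt_eqF.
have := ler_wpM2l (cabs_ge0 (d - V / W)) cw.
rewrite [in X in _ -> _ -> X]cabsM cabsV => h1 h2.
rewrite mulrA ler_pdivlMr//; lra.
Qed.

End PerturbedVandermonde.

(** * Roots of unity, and separation of the exponentials outside [E_delta] *)

Section RootsOfUnity.
Set Implicit Arguments.
Unset Strict Implicit.
Variable R : realType.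
Implicit Types (z w mu : R[i]) (x y : R).

(** sin(acos x) = sqrt(1 - x^2) recovers |Im z| / |z|, and the sign chosen in [carg] restores the
    sign of Im z. *)
Lemma polar z : z != 0 -> z = (cabs z)%:C * cexp (0 +i* carg z).
Proof.
move=> z0; have r0 : 0 < cabs z by rewrite cabs_gt0.
have q1 : -1 <= reC z / cabs z <= 1.
  by rewrite -ler_norml normrM normfV (ger0_norm (ltW r0)) ler_pdivrMr// mul1r reC_le_cabs.
have sq : Num.sqrt (1 - (reC z / cabs z) ^+ 2) = `|imC z| / cabs z.
  rewrite -[RHS]ger0_norm ?divr_ge0 ?(ltW r0)// -sqrtr_sqr; congr Num.sqrt.
  rewrite !exprMn real_normK ?num_real// exprVn.
  have r2 : cabs z ^+ 2 != 0 by rewrite expf_eq0 /= gt_eqF.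
  apply: (mulIf r2); rewrite mulrBl mul1r !mulfVK// cabs_sqr; ring.
apply: reC_eq; rewrite ?reCM ?imCM /= expR0 !mul1r mul0r ?subr0 ?addr0 /carg (negbTE z0).
  case: ifP => _; rewrite ?cosN acosK ?in_itv//=; field; exact: lt0r_neq0.
case: ifPn => [i0|]; rewrite ?sinN sin_acos// sq.
  by rewrite ger0_norm//; field; exact: lt0r_neq0.
by rewrite -ltNge => i0; rewrite ltr0_norm//; field; exact: lt0r_neq0.
Qed.

Lemma prootK n z : (0 < n)%N -> proot n z ^+ n = z.
Proof.
move=> n0; rewrite /proot; case: eqVneq => [->|z0]; first by rewrite expr0n gtn_eqF.
have nn : n%:R != 0 :> R by rewrite pnatr_eq0 -lt0n.
rewrite exprMn cexp_imM [n%:R * _]mulrC divfK// [RHS]polar//; congr (_ * _).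
by rewrite -rmorphXn /= -powR_mulrn ?powR_ge0// -powRrM mulVf// powRr1// cabs_ge0.
Qed.

Lemma rhoX n k : rho R n ^+ k = cexp (0 +i* (k%:R * (2 * pi / n%:R))).
Proof. exact: cexp_imM. Qed.

Lemma cabs_rhoX n k : cabs (rho R n ^+ k) = 1.
Proof. by rewrite rhoX cabs_cexp expR0. Qed.

Lemma cexp_2pi : cexp (0 +i* (2 * pi)) = 1 :> R[i].
Proof.
by rewrite /cexp /= mulr_natl cos2pi sin2pi expR0 mulr1 mulr0.
Qed.

Lemma rho_expn n : (0 < n)%N -> rho R n ^+ n = 1.
Proof.
move=> n0; rewrite rhoX mulrC divfK ?cexp_2pi//.
by rewrite pnatr_eq0 -lt0n.
Qed.

(** Sum-to-product: e^(i(Y+X)) - e^(i(Y-X)) = 2i sin X e^(iY), which exhibits the sine and the phase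
    in the centres of [E_delta]. *)
Lemma rhoXB n j k : (j <= k)%N -> rho R n ^+ k - rho R n ^+ j =
  (2 * sin (pi * (k - j)%:R / n%:R))%:C * ((0 +i* 1) * cexp (0 +i* (pi * (j + k)%:R / n%:R))).
Proof.
move=> jk; rewrite !rhoX natrB// natrD.
set X := pi * (k%:R - j%:R) / n%:R; set Y := pi * (j%:R + k%:R) / n%:R.
have -> : k%:R * (2 * pi / n%:R) = Y + X by rewrite /X /Y; ring.
have -> : j%:R * (2 * pi / n%:R) = Y - X by rewrite /X /Y; ring.
apply: reC_eq; rewrite ?reCD ?imCD ?reCN ?imCN ?reCM ?imCM /= expR0.
  by rewrite cosD cosB; ring.
by rewrite sinD sinB; ring.
Qed.

Lemma sin_frac_gt0 n d : (0 < d < n)%N -> 0 < sin (pi * d%:R / n%:R) :> R.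
Proof.
move=> /andP[d0 dn]; have n0 : 0 < n%:R :> R by rewrite ltr0n (ltn_trans d0).
have p0 := @pi_gt0 R.
apply: sin_gt0_pi; rewrite divr_gt0 ?mulr_gt0 ?(ltr0n R d)//=.
by rewrite ltr_pdivrMr// ltr_pM2l// ltr_nat.
Qed.

Lemma sin_frac_lb n : exists2 s : R, 0 < s &
  forall d, (0 < d < n)%N -> s <= sin (pi * d%:R / n%:R).
Proof.
(* The default 1 keeps the minimum positive when no index d is available. *)
exists (\big[Num.min/1]_(d < n | (0 < d)%N) sin (pi * d%:R / n%:R)).
  by apply: lt_bigmin => // d d0; apply: sin_frac_gt0; rewrite d0 /=.
move=> d /andP[d0 dn].
exact: (@bigmin_le_cond _ _ _ _ (Ordinal dn) _ (fun d : 'I_n => sin (pi * d%:R / n%:R))).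
Qed.

Lemma cabs_rhoXB n j k : (j < k < n)%N ->
  cabs (rho R n ^+ k - rho R n ^+ j) = 2 * sin (pi * (k - j)%:R / n%:R).
Proof.
move=> /andP[jk kn]; rewrite rhoXB ?(ltnW jk)// !cabsM cabs_cexp expR0 mulr1.
have -> : cabs (0 +i* 1) = 1 :> R by rewrite /cabs /= expr0n expr1n add0r sqrtr1.
rewrite cabs_real mulr1 ger0_norm// mulr_ge0// ltW// sin_frac_gt0//.
by rewrite subn_gt0 jk (leq_ltn_trans (leq_subr _ _)).
Qed.

Lemma cexp_2pi_int (m : int) : cexp (0 +i* (2 * pi * m%:~R)) = 1 :> R[i].
Proof.
have H k : cexp (0 +i* (2 * pi * k%:R)) = 1 :> R[i].
  by rewrite mulrC -cexp_imM cexp_2pi expr1n.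
case: m => k; first exact: H.
rewrite NegzE mulrNz mulrN.
have -> : 0 +i* (- (2 * pi * k.+1%:~R)) = - (0 +i* (2 * pi * k.+1%:R)) :> R[i].
  by apply: reC_eq; rewrite ?reCN ?imCN /= ?oppr0.
by rewrite cexpN H invr1.
Qed.

(** The zeros of 1 - e^w are the points 2 pi i m. Once Im w is shifted into [-pi, pi], distance
    delta from them forces Re w or Im w away from 0, and either case gives a lower bound. *)
Lemma one_sub_cexp_lb (delta : R) : 0 < delta -> exists2 c : R, 0 < c &
  forall w, reC w <= 0 ->
    (forall m : int, delta <= cabs (w - (0 +i* (2 * pi * m%:~R)))) ->
    c <= cabs (1 - cexp w).
Proof.
move=> d0; have p0 := @pi_gt0 R.
(* If |Re w| and the shifted |Im w| were both below delta / 2, the separation would fail; the cap at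
   pi keeps e' where cos is decreasing. *)
pose e := delta / 2; pose e' := Num.min e pi.
have e0 : 0 < e by rewrite divr_gt0.
have e'0 : 0 < e' by rewrite lt_min e0 p0.
have ce : cos e' < 1.
  rewrite -[ltRHS]cos0 ltr_cos// in_itv /= ?lexx ?(ltW p0)// (ltW e'0) /=.
  by rewrite ge_min lexx orbT.
have Ee : 0 < 1 - expR (- e)
  by rewrite subr_gt0 expR_lt1 oppr_lt0.
(* One entry per case below: Re w <= -e; |e^w| <= 1/2; |e^w| > 1/2 with the shifted |Im w| at least
   e. *)
pose q := Num.min ((1 - expR (- e)) ^+ 2) (Num.min 4^-1 (1 - cos e')).
have q0 : 0 < q by rewrite !lt_min exprn_gt0//= invr_gt0 ltr0n subr_gt0.
exists (Num.sqrt q); first by rewrite sqrtr_gt0.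
move=> w w0 sep; rewrite /cabs ler_sqrt ?addr_ge0 ?sqr_ge0//.
pose m := Num.floor ((imC w + pi) / (2 * pi)).
pose y := imC w - 2 * pi * m%:~R.
have dw : delta <= cabs (reC w +i* y).
  have -> : reC w +i* y = w - (0 +i* (2 * pi * m%:~R)).
    by apply: reC_eq; rewrite ?reCD ?imCD ?reCN ?imCN /= ?oppr0 ?addr0.
  exact: sep.
have -> : cexp w = cexp (reC w +i* y).
  rewrite -[RHS]mulr1 -(cexp_2pi_int m) -cexpD; congr cexp.
  by apply: reC_eq; rewrite ?reCD ?imCD /= ?addr0 /y; ring.
have ypi : `|y| <= pi.
  have := floor_itv ((imC w + pi) / (2 * pi)).
  rewrite -/m intrD ler_pdivlMr ?ltr_pdivrMr ?mulr_gt0// => /andP[h1 h2].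
  by rewrite ler_norml /y; apply/andP; split; lra.
rewrite reCD imCD reCN imCN /=.
(* This form has two nonnegative summands, either of which can serve alone as a lower bound. *)
have -> : (1 - expR (reC w) * cos y) ^+ 2 + (0 - expR (reC w) * sin y) ^+ 2 =
   (1 - expR (reC w)) ^+ 2 + 2 * expR (reC w) * (1 - cos y).
  apply/eqP; rewrite -subr_eq0; apply/eqP.
  transitivity (expR (reC w) ^+ 2 * (cos y ^+ 2 + sin y ^+ 2 - 1)); first by ring.
  by rewrite cos2Dsin2 subrr mulr0.
have E1 : expR (reC w) <= 1 by rewrite expR_le1.
have E0 := expR_gt0 (reC w).
have cy : 0 <= 1 - cos y by rewrite subr_ge0 cos_le1.
have [xe|xe] := lerP e (- reC w).
  rewrite /q ge_min; apply/orP; left.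
  have : expR (reC w) <= expR (- e) by rewrite ler_expR; lra.
  move=> /(lerB (lexx 1)) h; apply: (@le_trans _ _ ((1 - expR (reC w)) ^+ 2)).
    by rewrite ler_pXn2r// nnegrE ?(ltW Ee)// subr_ge0.
  by rewrite lerDl mulr_ge0 ?mulr_ge0 ?(ltW E0).
have ye : e <= `|y|.
  rewrite leNgt; apply/negP => ye; move: dw; apply/negP; rewrite -ltNge.
  have -> : reC w +i* y = (reC w)%:C + (0 +i* 1) * y%:C.
    by apply: reC_eq; rewrite ?reCD ?imCD ?reCM ?imCM /=; ring.
  apply: le_lt_trans (cabsD _ _) _; rewrite cabsM !cabs_real.
  rewrite (_ : cabs (0 +i* 1) = 1); last by rewrite /cabs /= expr0n expr1n add0r sqrtr1.
  rewrite mul1r ler0_norm//; move: xe ye; rewrite /e; lra.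
have ce' : cos y <= cos e'.
  have -> : cos y = cos `|y| by case: (ger0P y) => // _; rewrite cosN.
  rewrite le_eqVlt orbC; case: (ltrP e' `|y|) => [h|h].
    by rewrite ltr_cos ?h // in_itv /= ?(ltW e'0) ?normr_ge0 ?ypi //= ge_min lexx orbT.
  by rewrite (_ : e' = `|y|) ?eqxx ?orbT//; apply/le_anti; rewrite h ge_min ye.
have [E2|E2] := lerP (expR (reC w)) 2^-1.
  apply: (@le_trans _ _ 4^-1); first by rewrite /q !ge_min lexx ?orbT.
  apply: (@le_trans _ _ ((1 - expR (reC w)) ^+ 2)); last first.
    by rewrite lerDl mulr_ge0 ?mulr_ge0 ?(ltW E0).
  have -> : 4^-1 = 2^-1 ^+ 2 :> R by lra.
  by rewrite ler_pXn2r ?nnegrE ?subr_ge0//; lra.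
apply: (@le_trans _ _ (1 - cos e')); first by rewrite /q !ge_min lexx !orbT.
apply: le_trans (lerB (lexx 1) ce') _.
apply: ler_wpDl; first exact: sqr_ge0.
by rewrite -[leLHS]mul1r ler_wpM2r//; lra.
Qed.

(** The centres of [E_delta] are exactly the mu at which two of these exponentials coincide.
    Factoring out the exponential of larger modulus reduces the claim to [one_sub_cexp_lb]. *)
Lemma cexp_separation n (b delta : R) : 0 < b -> 0 < delta ->
  exists2 c : R, 0 < c & forall mu, ~ E_delta n b delta mu ->
    forall j k : nat, (j < k < n)%N ->
      let a i := cexp (rho R n ^+ i * mu * b%:C) in
      c * Num.max (cabs (a j)) (cabs (a k)) <= cabs (a k - a j).
Proof.
move=> b0 d0; have [s s0 sle] := sin_frac_lb n.
(* The factor |(rho^k - rho^j) b| is at least 2 s b, and mu is at distance at least delta from each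
   centre. *)
have [|c c0 cle] := @one_sub_cexp_lb (2 * s * b * delta); first by rewrite !mulr_gt0.
exists c => // mu muE j k /[dup] jkn /andP[jk kn] /=.
pose wi i := rho R n ^+ i * mu * b%:C.
have dn : (0 < k - j < n)%N by rewrite subn_gt0 jk (leq_ltn_trans (leq_subr _ _)).
pose S := sin (pi * (k - j)%:R / n%:R) : R.
have S0 : 0 < S by exact: sin_frac_gt0.
have sep (m : int) : 2 * s * b * delta <= cabs (wi k - wi j - (0 +i* (2 * pi * m%:~R))).
  have E : wi k - wi j - (0 +i* (2 * pi * m%:~R)) =
     (rho R n ^+ k - rho R n ^+ j) * b%:C *
     (mu - (pi * m%:~R / (b * S))%:C * cexp (0 +i* (- (pi * (j + k)%:R / n%:R)))).
    rewrite [RHS]mulrBr; congr (_ - _); first by rewrite /wi; ring.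
    rewrite rhoXB ?(ltnW jk)// -/S; set Y := pi * (j + k)%:R / n%:R.
    have eY : cexp (0 +i* Y) * cexp (0 +i* (- Y)) = 1 :> R[i].
      rewrite -cexpD -[RHS]cexp0; congr cexp.
      by apply: reC_eq; rewrite ?reCD ?imCD /=; ring.
    transitivity ((2 * S)%:C * b%:C * (pi * m%:~R / (b * S))%:C * (0 +i* 1) *
       (cexp (0 +i* Y) * cexp (0 +i* (- Y)))); last by ring.
    rewrite eY mulr1 -!rmorphM /=.
    have -> : 2 * S * b * (pi * m%:~R / (b * S)) = 2 * pi * m%:~R.
      by field; rewrite !gt_eqF.
    by apply: reC_eq; rewrite ?reCM ?imCM /=; ring.
  rewrite E !cabsM cabs_rhoXB// -/S cabs_real (ger0_norm (ltW b0)).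
  apply: ler_pM => //.
  - by rewrite !mulr_ge0// ltW.
  - exact: ltW.
  - by rewrite ler_wpM2r ?ler_pM2l ?(ltW b0)// sle.
  rewrite leNgt; apply/negP => lt; apply: muE.
  (* [E_delta] counts the roots from 1, so its j + k - 2 is j + k in the present indices. *)
  exists m, j.+1, k.+1; split => //.
  by rewrite subSS addSn addnS !subSS subn0.
have key (z1 z2 : R[i]) : reC z1 <= reC z2 ->
    (forall m : int, 2 * s * b * delta <= cabs (z1 - z2 - (0 +i* (2 * pi * m%:~R)))) ->
    c * Num.max (cabs (cexp z1)) (cabs (cexp z2)) <= cabs (cexp z2 - cexp z1).
  move=> z12 H; rewrite (_ : Num.max _ _ = cabs (cexp z2)); last first.
    by apply/max_idPr; rewrite !cabs_cexp ler_expR.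
  have -> : cexp z2 - cexp z1 = (1 - cexp (z1 - z2)) * cexp z2.
    by rewrite mulrBl mul1r -cexpD subrK.
  by rewrite cabsM ler_wpM2r ?cabs_ge0// cle// reCD reCN subr_le0.
have [h|/ltW h] := lerP (reC (wi j)) (reC (wi k)).
  apply: key => // m; rewrite -cabsN.
  rewrite (_ : - _ = wi k - wi j - (0 +i* (2 * pi * (- m)%:~R))) ?sep//.
  by rewrite mulrNz; apply: reC_eq; rewrite !(reCD, imCD, reCN, imCN) /=; ring.
by rewrite maxC cabs_sub; exact: key.
Qed.

(** All rho^j mu have modulus |mu|, so only a lower bound for the chords 2 sin(pi (k - j) / n) is
    required. *)
Lemma rho_separation n : exists2 c : R, 0 < c & forall mu (j k : nat), (j < k < n)%N ->
  c * Num.max (cabs (rho R n ^+ j * mu)) (cabs (rho R n ^+ k * mu)) <=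
    cabs (rho R n ^+ k * mu - rho R n ^+ j * mu).
Proof.
have [s s0 sle] := sin_frac_lb n; exists (2 * s); first by rewrite mulr_gt0.
move=> mu j k /[dup] jkn /andP[jk kn].
rewrite -mulrBl !cabsM cabs_rhoXB// !cabs_rhoX mul1r maxxx ler_wpM2r ?cabs_ge0//.
by rewrite ler_pM2l// sle// subn_gt0 jk (leq_ltn_trans (leq_subr _ _)).
Qed.

Lemma rho_neq0 n k : rho R n ^+ k != 0.
Proof. by rewrite -cabs_gt0 cabs_rhoX. Qed.

(** A geometric sum of ratio q with q^n = 1; q = 1 forces m = k because chords between distinct
    powers are nonzero. *)
Lemma rho_orthogonal n (m k : 'I_n) :
  \sum_(i < n) (rho R n ^+ i) ^- m * (rho R n ^+ i) ^+ k = (m == k)%:R * n%:R.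
Proof.
have n0 : (0 < n)%N by apply: leq_ltn_trans (ltn_ord m).
pose q := rho R n ^- m * rho R n ^+ k.
rewrite (eq_bigr (fun i : 'I_n => q ^+ i)); last first.
  by move=> i _; rewrite /q exprMn exprVn -!exprM !(mulnC i).
case: eqVneq => [mk|mk].
  rewrite mul1r /q mk mulVf ?rho_neq0//.
  by under eq_bigr do rewrite expr1n; rewrite sumr_const card_ord.
rewrite mul0r; apply/eqP; have : q ^+ n - 1 = 0.
  by rewrite /q exprMn exprVn -!exprM !(mulnC _ n) !exprM rho_expn// !expr1n invr1 mulr1 subrr.
rewrite subrX1 => /eqP; rewrite mulf_eq0 => /orP[|//].
rewrite subr_eq0 => /eqP q1; exfalso.
have mkE : rho R n ^+ k = rho R n ^+ m.
  by rewrite -[LHS](mulVKf (rho_neq0 n m)) -/q q1 mulr1.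
have no_eq (i l : 'I_n) : (i < l)%N -> rho R n ^+ l != rho R n ^+ i.
  move=> il; rewrite -subr_eq0 -cabs_gt0 cabs_rhoXB ?il ?ltn_ord// mulr_gt0//.
  by rewrite sin_frac_gt0// subn_gt0 il (leq_ltn_trans (leq_subr _ _)).
move: mk; rewrite -val_eqE /= neq_ltn => /orP[] /no_eq /eqP; exact.
Qed.

End RootsOfUnity.

(** * Solutions close to a single exponential, through Fourier diagonalization *)

Section BirkhoffSolutions.
Set Implicit Arguments.
Unset Strict Implicit.
Variables (R : realType) (n' : nat).
Let n := n'.+1.
Variables (p : nat -> R -> R[i]) (M : R) (mu : R[i]) (u : nat -> R -> R[i]).
Hypothesis pM : forall k x, (k < n')%N -> cabs (p k x) <= M.
Hypothesis M0 : 0 <= M.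
Hypothesis mu1 : 1 <= cabs mu.
Hypothesis u_fund : fundamental_system n p (mu ^+ n) u.
Implicit Types (c : 'I_n -> R[i]) (x : R).

Let mu0 : mu != 0.
Proof. by rewrite -cabs_gt0 (lt_le_trans _ mu1). Qed.

Let q (i : nat) := rho R n ^+ i * mu.

Let q0 i : q i != 0.
Proof. by rewrite mulf_neq0 ?rho_neq0. Qed.

Let qn i : q i ^+ n = mu ^+ n.
Proof. by rewrite exprMn -exprM mulnC exprM rho_expn// expr1n mul1r. Qed.

Let cabs_q i : cabs (q i) = cabs mu.
Proof. by rewrite cabsM cabs_rhoX mul1r. Qed.

Definition comb_deriv c m x := \sum_k c k * cderivn m (u k) x.

(* The first-order system for (y, y'/mu, y''/mu^2, ...) with constant coefficients is
   diagonalized by the discrete Fourier transform; mode i is its i-th component. *)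
Definition mode c (i : nat) x := n%:R^-1 * \sum_(m < n) q i ^- m * comb_deriv c m x.

(** The lower-order terms of the equation enter only the last component of the first-order system;
    this is their contribution to the i-th mode. *)
Definition mode_coupling c (i : nat) x :=
  - (n%:R^-1 * (q i ^- n' * \sum_(k < n') p k x * comb_deriv c k x)).

Lemma comb_deriv_has_cderiv c m x : (m < n)%N ->
  has_cderiv (comb_deriv c m) x (comb_deriv c m.+1 x).
Proof.
move=> mn; apply: has_cderiv_sum => k; apply: has_cderivZ.
have [ud _ _] := u_fund (ltn_ord k); have [dr di] := ud m x mn.
have is_d (f : R -> R) : derivable (derive1n m f) x 1 ->
    is_derive x 1 (derive1n m f) (derive1n m.+1 f x).
  by move=> d; rewrite derive1nS derive1E; exact: DeriveDef.
by split; exact: is_d.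
Qed.

Lemma comb_deriv_ode c x : comb_deriv c n x =
  mu ^+ n * comb_deriv c 0 x - \sum_(k < n') p k x * comb_deriv c k x.
Proof.
apply/eqP; rewrite eq_sym subr_eq eq_sym; apply/eqP; rewrite /comb_deriv.
under [X in _ + X]eq_bigr do rewrite mulr_sumr.
rewrite exchange_big /= mulr_sumr -big_split /=; apply: eq_bigr => k _.
have [_ /(_ x) ode _] := u_fund (ltn_ord k).
rewrite -[cderivn 0 _ _]/(Complex (reC (u k x)) (imC (u k x))).
have -> : Complex (reC (u k x)) (imC (u k x)) = u k x by case: (u k x).
rewrite mulrCA -ode mulrDr mulr_sumr; congr (_ + _).
by apply: eq_bigr => i _; rewrite mulrCA.
Qed.

Lemma comb_deriv0 c (m : 'I_n) : comb_deriv c m 0 = c m.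
Proof.
rewrite /comb_deriv (bigD1 m)//= big1 ?addr0 => [|k km].
  by have [_ _ ->//] := u_fund (ltn_ord m); rewrite eqxx mulr1.
have [_ _ ->//] := u_fund (ltn_ord k).
by rewrite eq_sym val_eqE (negbTE km) mulr0.
Qed.

(** Fourier inversion, from the orthogonality of the powers of [rho]. *)
Lemma comb_deriv_mode c (m : 'I_n) x :
  comb_deriv c m x = \sum_(i < n) q i ^+ m * mode c i x.
Proof.
have nn : n%:R != 0 :> R[i] by rewrite pnatr_eq0.
under eq_bigr => i _.
  rewrite /mode mulrCA !mulr_sumr.
  under eq_bigr => k _.
    have -> : n%:R^-1 * (q i ^+ m * (q i ^- k * comb_deriv c k x)) =
       ((rho R n ^+ i) ^- k * (rho R n ^+ i) ^+ m) *
       (n%:R^-1 * mu ^+ m * mu ^- k * comb_deriv c k x).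
      by rewrite /q !exprMn invfM; ring.
    over.
  over.
rewrite exchange_big /= (bigD1 m)//= [X in _ + X]big1 ?addr0 => [|k km].
  rewrite -mulr_suml rho_orthogonal eqxx mul1r mulrA.
  by rewrite !mulrA mulfV// mul1r mulfV ?mul1r// expf_neq0.
by rewrite -mulr_suml rho_orthogonal (negbTE km) !mul0r.
Qed.

(** Differentiation shifts m to m + 1, which multiplies the mode by q_i; the top derivative wraps
    around to order 0 through the equation and q_i^n = mu^n. *)
Lemma mode_has_cderiv c i x :
  has_cderiv (mode c i) x (q i * mode c i x + mode_coupling c i x).
Proof.
have := has_cderivZ n%:R^-1 (has_cderiv_sum (fun m : 'I_n =>
  has_cderivZ (q i ^- m) (comb_deriv_has_cderiv c x (ltn_ord m)))).
congr has_cderiv; rewrite /mode /mode_coupling big_ord_recr big_ord_recl /=.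
rewrite comb_deriv_ode expr0 invr1 mul1r -(qn i).
set A := \sum_(m < n') q i ^- _ * comb_deriv c m.+1 x.
set B := \sum_(m < n') q i ^- _ * _; set P := \sum_(k < n') p k x * _.
have AB : q i * B = A.
  rewrite mulr_sumr; apply: eq_bigr => m _.
  by rewrite /= /bump /= add1n exprS invfM !mulrA mulfV// mul1r.
transitivity (n%:R^-1 * (A + (q i * comb_deriv c 0 x - q i ^- n' * P))).
  by congr (_ * (_ + _)); rewrite mulrBr mulrA exprSr mulKf ?expf_neq0.
by rewrite -AB; ring.
Qed.

(** The gain 1/|mu| arises here: only derivatives of order at most n - 2 occur, each of size
    |mu|^(n-2) times the sum of the modes, against the division by |mu|^(n-1). *)
Lemma mode_coupling_bound c i x :
  cabs (mode_coupling c i x) <= M / cabs mu * \sum_(k < n) cabs (mode c k x).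
Proof.
set S := \sum_(k < n) _.
have S0 : 0 <= S by apply: sumr_ge0 => k _; exact: cabs_ge0.
have r0 : 0 < cabs mu by rewrite cabs_gt0.
have term (k : 'I_n') : cabs (p k x * comb_deriv c k x) <= M * (cabs mu ^+ n' / cabs mu * S).
  rewrite cabsM; apply: ler_pM; rewrite ?cabs_ge0 ?pM//.
  have kn : (k < n)%N by rewrite ltnS ltnW.
  have /= -> := comb_deriv_mode c (Ordinal kn) x.
  apply: le_trans (cabs_sum _ _ _) _; rewrite mulr_sumr; apply: ler_sum => l _.
  rewrite cabsM cabsX cabs_q ler_wpM2r ?cabs_ge0// ler_pdivlMr// -exprSr.
  by rewrite ler_weXn2l.
rewrite /mode_coupling cabsN !cabsM !cabsV !cabsX cabs_q.
have -> : cabs n%:R = n%:R :> R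
  by rewrite -(rmorph_nat (real_complex R)) cabs_real normr_nat.
rewrite -mulrA ler_pdivrMl ?ltr0n// ler_pdivrMl ?exprn_gt0//.
apply: le_trans (cabs_sum _ _ _) _.
apply: le_trans (ler_sum _ (fun k _ => term k)) _.
rewrite sumr_const card_ord -[leLHS]mulr_natl.
rewrite [leRHS](_ : _ = n%:R * (M * (cabs mu ^+ n' / cabs mu * S))); last by ring.
by rewrite ler_wpM2r ?ler_nat ?leqnSn// !mulr_ge0 ?invr_ge0 ?exprn_ge0 ?(ltW r0).
Qed.

(** Allows boundary data of the modes to be written as a matrix applied to c. *)
Lemma mode_lin c i x : mode c i x =
  \sum_k c k * mode (fun l => (l == k)%:R) i x.
Proof.
rewrite /mode mulr_sumr.
under eq_bigr => m _ do rewrite /comb_deriv mulrA mulr_sumr.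
rewrite exchange_big /=; apply: eq_bigr => k _.
rewrite mulrCA mulr_sumr mulr_sumr; apply: eq_bigr => m _.
rewrite /comb_deriv (bigD1 k)//= eqxx mul1r big1 ?addr0 => [|l lk].
  by ring.
by rewrite (negbTE lk) mul0r.
Qed.

Section Mode.
Variables (L : R) (j : 'I_n).
Hypothesis L0 : 0 <= L.
Hypothesis kL : n%:R * (M / cabs mu * L) <= 2^-1.

(** Exponents relative to q_j; [pt] is the endpoint from which each mode is integrated stably. *)
Let a (i : 'I_n) := q i - q j.
Let pt (i : 'I_n) : R := if reC (a i) <= 0 then 0 else L.
Let e x := cexp (q j * x%:C).

(** Division by exp(q_j x) replaces q_i by a_i, so the j-th exponent vanishes and [dichotomy_bound]
    applies with kappa = M / |mu|. *)
Lemma mode_dichotomy c d :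
  (forall i : 'I_n, mode c i (pt i) = (i == j)%:R * d * e (pt i)) ->
  forall (i : 'I_n) x, 0 <= x <= L ->
    cabs (mode c i x - (i == j)%:R * d * e x) <=
      2 * (M / cabs mu * L) * cabs d * cabs (e x).
Proof.
move=> bd i x xL.
have eN y : cexp (- q j * y%:C) = (e y)^-1 by rewrite mulNr cexpN.
have e0 y : e y != 0 by exact: cexp_neq0.
pose w (i : 'I_n) y := (e y)^-1 * mode c i y.
have := @dichotomy_bound R n w (fun i y => (e y)^-1 * mode_coupling c i y) a j d
  (M / cabs mu) L L0 _ kL.
move=> /(_ _ _ _ _ _ i x xL) H.
have -> : mode c i x - (i == j)%:R * d * e x = e x * (w i x - (i == j)%:R * d).
  by rewrite /w mulrBr mulVKf// [e x * _]mulrC.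
rewrite cabsM mulrC ler_wpM2r ?cabs_ge0//; apply: H.
- by rewrite divr_ge0 ?cabs_ge0.
- move=> l y; rewrite /w.
  have := has_cderivM (has_cderiv_cexp (- q j) y) (mode_has_cderiv c l y).
  rewrite eN => H; apply: has_cderiv_ext (_ : has_cderiv _ y _) => [z|].
    by rewrite -eN.
  by move: H; congr has_cderiv; rewrite /a; ring.
- move=> l y _; rewrite cabsM.
  rewrite [leRHS](_ : _ = cabs (e y)^-1 * (M / cabs mu * \sum_(k < n) cabs (mode c k y))).
    by rewrite ler_wpM2l ?cabs_ge0 ?mode_coupling_bound.
  rewrite mulrCA; congr (_ * _); rewrite mulr_sumr.
  by apply: eq_bigr => k _; rewrite /w cabsM.
- by rewrite /a subrr.
- by move=> l; rewrite /w -/(pt l) bd mulrC mulfK.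
Qed.

(* The a priori bound with d = 0 makes the boundary-value map injective on the
   n-dimensional space of combinations of the u k, hence surjective. *)
Lemma birkhoff_solution : exists c,
  let eps := 2 * n%:R * (M / cabs mu * L) in
  (forall k : 'I_n, cabs (c k - q j ^+ k) <= eps * cabs (q j) ^+ k) /\
  (forall x, 0 <= x <= L ->
     cabs (\sum_(k < n) c k * u k x - cexp (q j * x%:C)) <=
       eps * cabs (cexp (q j * x%:C))).
Proof.
pose B := \matrix_(k < n, i < n) mode (fun l => (l == k)%:R) i (pt i).
have modeB (v : 'rV_n) (i : 'I_n) : mode (v 0) i (pt i) = (v *m B) 0 i.
  by rewrite mode_lin mxE; apply: eq_bigr => k _; rewrite !mxE.
have Bu : B \in unitmx.
  rewrite -row_free_unit; apply: inj_row_free => v vB0.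
  have z0 (i : 'I_n) : mode (v 0) i 0 = 0.
    have := @mode_dichotomy (v 0) 0 _ i 0.
    rewrite !mulr0 !mul0r subr0 cabs0 mulr0 mul0r lexx L0 => H.
    apply/eqP; rewrite -cabs_eq0; apply/eqP/le_anti; rewrite cabs_ge0 andbT.
    by apply: H => // k; rewrite mulr0 mul0r modeB vB0 mxE.
  apply/rowP => m; rewrite mxE -comb_deriv0 comb_deriv_mode big1// => i _.
  by rewrite z0 mulr0.
(* The boundary data are those of the pure exponential: mode j equals exp(q_j x) at its endpoint,
   the other modes vanish at theirs. *)
pose v := (\row_i ((i == j)%:R * e (pt i))) *m invmx B.
exists (v 0) => eps.
have vb (i : 'I_n) x : 0 <= x <= L ->
    cabs (mode (v 0) i x - (i == j)%:R * e x) <= 2 * (M / cabs mu * L) * cabs (e x).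
  have := @mode_dichotomy (v 0) 1 _ i x; rewrite cabs1 !mulr1; apply => k.
  by rewrite modeB mulmxKV// mxE mulr1.
(* Inverting the transform sums n modes with weights of modulus |mu|^m, whence the factor n in
   eps. *)
have main (m : 'I_n) x : 0 <= x <= L ->
    cabs (comb_deriv (v 0) m x - q j ^+ m * e x) <= eps * cabs (q j ^+ m * e x).
  move=> xL; have sumE : q j ^+ m * e x = \sum_(i < n) q i ^+ m * ((i == j)%:R * e x).
    rewrite (bigD1 j)//= eqxx mul1r big1 ?addr0// => i /negbTE ->.
    by rewrite mul0r mulr0.
  rewrite [in leLHS]sumE comb_deriv_mode -sumrB; apply: le_trans (cabs_sum _ _ _) _.
  have bd (i : 'I_n) : cabs (q i ^+ m * mode (v 0) i x - q i ^+ m * ((i == j)%:R * e x))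
      <= cabs mu ^+ m * (2 * (M / cabs mu * L) * cabs (e x)).
    by rewrite -mulrBr cabsM cabsX cabs_q ler_wpM2l ?exprn_ge0 ?cabs_ge0// vb.
  apply: le_trans (ler_sum _ (fun i _ => bd i)) _.
  rewrite sumr_const card_ord -[leLHS]mulr_natl.
  by rewrite cabsM cabsX cabs_q /eps le_eqVlt; apply/orP; left; apply/eqP; ring.
split=> [k|x xL].
  have := main k 0; rewrite lexx L0 => /(_ isT).
  by rewrite /e mulr0 cexp0 !mulr1 cabsX comb_deriv0.
have := main ord0 x xL; rewrite expr0 !mul1r; congr (cabs (_ - _) <= _).
by apply: eq_bigr => k _; congr (_ * _); rewrite /cderivn /=; case: (u k x).
Qed.

End Mode.

End BirkhoffSolutions.

(** * Choice of constants and the quotient of the two perturbed determinants *)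

Theorem theorem4 (R : realType) (n : nat) (b : R) (T : set R)
    (p : nat -> R -> R -> R[i]) (M : R)
    (u : nat -> R[i] -> R -> R -> R[i]) :
  (2 <= n)%N -> 0 < b -> is_interval T ->
  (* p_k is C^infinity in (x,t) (real and imaginary parts), for t in T *)
  (forall k x t, (k <= n - 2)%N -> T t ->
     smooth_at (fun x t => reC (p k x t)) x t /\
     smooth_at (fun x t => imC (p k x t)) x t) ->
  (* b-periodic in x *)
  (forall k x t, (k <= n - 2)%N -> T t -> p k (x + b) t = p k x t) ->
  (* uniformly bounded *)
  (forall k x t, (k <= n - 2)%N -> T t -> cabs (p k x t) <= M) ->
  (* u_j(x; lam; t) = u j lam t x are the fundamental solutions *)
  (forall lam t, T t ->
     fundamental_system n (fun k x => p k x t) lam (fun j => u j lam t)) ->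
  forall delta : R, 0 < delta ->
  exists C R0 : R, forall (lam : R[i]) (t : R), T t ->
    R0 <= cabs lam -> ~ E_delta n b delta (proot n lam) ->
    cabs (Hdet n b (fun j => u j lam t) - Htilde n b lam)
      <= C * (cabs (proot n lam))^-1 * cabs (Htilde n b lam).
Proof.
case: n => [|[|n']] // _ b0 _ _ _ pM ufund delta d0.
set n := n'.+2.
(* The bound is made nonnegative, and [0, L] contains every evaluation point i b with i < n. *)
pose M' := Num.max M 0; pose L := n%:R * b.
have M'0 : 0 <= M' by rewrite /M' le_max lexx orbT.
have L0 : 0 <= L by rewrite mulr_ge0 ?ler0n ?ltW.
have [c1 c10 sep1] := cexp_separation n b0 d0.
have [c2 c20 sep2] := rho_separation R n.
have [K1 K10 V1] := perturbed_Vandermonde n c10.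
have [K2 K20 V2] := perturbed_Vandermonde n c20.
pose E := 2 * n%:R * M' * L.
have E0 : 0 <= E by do 2!apply: mulr_ge0 => //; apply: mulr_ge0; rewrite ler0n.
(* The summands ensure |mu| >= 1, E / |mu| <= 1 and K2 E / |mu| <= 1/2 respectively. *)
pose r0 := 1 + E + 2 * K2 * E.
have KE : 0 <= K2 * E by rewrite mulr_ge0// ltW.
have r01 : 1 <= r0 by rewrite /r0; lra.
(* The first constant is that of [quotient_perturb] for relative errors K1 E / |mu| and K2 E / |mu|;
   the second is an n-th power because |lam| = |mu|^n. *)
exists (2 * (K1 + K2) * E), (r0 ^+ n) => lam t Tt lamR lamE.
set mu := proot n lam in lamE *.
have muE : mu ^+ n = lam by exact: prootK.
have rmu : r0 <= cabs mu.
  by rewrite -(@ler_pXn2r _ n) ?nnegrE ?cabs_ge0 ?(le_trans ler01 r01)// -cabsX muE.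
have mu1 : 1 <= cabs mu := le_trans r01 rmu.
have mup : 0 < cabs mu := lt_le_trans ltr01 mu1.
pose eps := E / cabs mu.
have eps1 : eps <= 1 by rewrite ler_pdivrMr// mul1r (le_trans _ rmu)// /r0; lra.
have eps0 : 0 <= eps by rewrite divr_ge0// ltW.
have K2eps : K2 * eps <= 2^-1.
  rewrite /eps mulrA ler_pdivrMr// -ler_pdivrMl ?invr_gt0// invrK (le_trans _ rmu)// /r0; lra.
have epsE : 2 * n%:R * (M' / cabs mu * L) = eps by rewrite /eps /E; ring.
have kL : n%:R * (M' / cabs mu * L) <= 2^-1.
  by move: eps1; rewrite -epsE -mulrA; move: (n%:R * _) => z; lra.
have uf := ufund lam t Tt; rewrite -muE in uf.
have pM' k x : (k < n'.+1)%N -> cabs (p k x t) <= M'.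
  by move=> kn; rewrite /M' le_max pM// subn2.
have [cc ccP] := fin_all_exists (fun j : 'I_n => birkhoff_solution pM' M'0 mu1 uf j L0 kL).
pose a (j : 'I_n) := cexp (rho R n ^+ j * mu * b%:C).
pose q (j : 'I_n) := rho R n ^+ j * mu.
pose C := \matrix_(k < n, j < n) cc j k.
pose U := \matrix_(i < n, j < n) u j lam t (i%:R * b).
have aX (i j : 'I_n) : cexp (q j * (i%:R * b)%:C) = a j ^+ i.
  by rewrite /a -cexpMn; congr cexp; rewrite rmorphM rmorph_nat mulrCA.
(* Column j of U C samples the j-th solution at the points i b, where the exponential is a_j^i; thus
   det U, which is H, equals det(U C) / det C. *)
have detY : cabs (\det (U *m C) - \det (Vandermonde n (\row_j a j))) <=
    K1 * eps * cabs (\det (Vandermonde n (\row_j a j))).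
  apply: V1 => [j k jk||i j].
  - by apply: sep1 => //; rewrite jk ltn_ord.
  - by rewrite eps0.
  - have [_ /(_ (i%:R * b))] := ccP j.
    rewrite epsE -/(q j) aX cabsX muE => H; rewrite mxE.
    rewrite (eq_bigr (fun k : 'I_n => cc j k * u k lam t (i%:R * b))).
      by apply: H; rewrite mulr_ge0 ?ler0n ?(ltW b0)//= ler_wpM2r ?(ltW b0)// ler_nat ltnW.
    by move=> k _; rewrite !mxE mulrC.
have detC : cabs (\det C - \det (Vandermonde n (\row_j q j))) <=
    K2 * eps * cabs (\det (Vandermonde n (\row_j q j))).
  apply: V2 => [j k jk||i j].
  - by apply: sep2; rewrite jk ltn_ord.
  - by rewrite eps0.
  - by have [/(_ i) + _] := ccP j; rewrite epsE mxE.
have W0 : \det (Vandermonde n (\row_j q j)) != 0.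
  rewrite det_Vandermonde; apply/prodf_neq0 => j _; apply/prodf_neq0 => k jk.
  rewrite !mxE -cabs_gt0; apply: lt_le_trans (sep2 mu j k _); last by rewrite jk ltn_ord.
  by rewrite mulr_gt0// lt_max cabsM cabs_rhoX mul1r mup.
have HtE : Htilde n b lam =
    \det (Vandermonde n (\row_j a j)) / \det (Vandermonde n (\row_j q j)).
  rewrite !det_Vandermonde -prodf_div; apply: eq_bigr => j _.
  rewrite -prodf_div; apply: eq_bigr => k _.
  by rewrite !mxE /a /q -mulrBl.
rewrite HtE; apply: le_trans (quotient_perturb (det_mulmx U C) W0 K2eps detY detC) _.
by rewrite le_eqVlt; apply/orP; left; apply/eqP; rewrite /eps; ring.
Qed.
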